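(* Let $X$ be a real Hilbert space, $g\in\Gamma_0(X)$, $h:X\to\mathbb{R}$ convex and differentiable with $L$-Lipschitz gradient, $L\in]0,+\infty[$, and $f=g+h$, with $f$ bounded from below. Let $\lambda\in]0,2L^{-1}[$, $x_0\in X$, and $x_{n+1}=\operatorname{prox}_{\lambda g}(x_n-\lambda\nabla h(x_n))$ for $n\in\mathbb{N}$ (the forward-backward algorithm). Assume that, for some $\Omega\subset X$: (a) $x_n\in\Omega$ for all $n\in\mathbb{N}$; (b) $f$ is $p$-Łojasiewicz on $\Omega$ with constant $c_{f,\Omega}$, for some $p\in]-\infty,0[$. Then there is a constant $C_p'>0$ such that $$\forall n\in\mathbb{N},\quad f(x_n)-\inf f\le (C_p')^{\frac{p}{p-2}}\,n^{\frac{p}{2-p}}.$$ When $0<r_0:=f(x_0)-\inf f<+\infty$, one can take, with $\kappa:=\lambda(2-\lambda L)[2c_{f,\Omega}^2]^{-1}$, $$(C_p')^{-1}=\min\left\{\kappa,\kappa^{\frac{p-2}{2p-2}}\right\}\max_{s\ge1}\min\left\{\frac{p-2}{ps},\ \kappa^{\frac{2-p}{2p-2}}r_0^{\frac{2-p}{p}}\left(1-s^{-\frac{p-2}{2p-2}}\right)\right\}.$$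
   Context: $\Gamma_0(X)$ is the set of proper, convex, lower semicontinuous functions $X\to]-\infty,+\infty]$. $\operatorname{prox}_{\lambda g}(x)=\operatorname{argmin}_{u\in X}\{g(u)+\frac1{2\lambda}\|u-x\|^2\}$. $\operatorname{dom}^*f:=\operatorname{dom} f\setminus\operatorname{argmin} f$; $\|\partial f(x)\|_-:=\operatorname{dist}(0,\partial f(x))$, equal to $+\infty$ if $\partial f(x)=\emptyset$, where $\partial f$ is the convex subdifferential. For $p\in]-\infty,0[$ and $f\in\Gamma_0(X)$ bounded from below (possibly without minimizers), $f$ is $p$-Łojasiewicz on $\Omega$ with constant $c_{f,\Omega}>0$ if $(f(x)-\inf f)^{1-1/p}\le c_{f,\Omega}\|\partial f(x)\|_-$ for all $x\in\Omega\cap\operatorname{dom}^*f$. Right-hand sides are allowed to equal $+\infty$ (with $0^{-s}=+\infty$ for $s>0$). *)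

(* Defs.v *)
From HB Require Import structures.
From mathcomp Require Import all_boot all_order all_algebra.
From mathcomp Require Import all_classical all_reals all_analysis.
Set Implicit Arguments.
Unset Strict Implicit.
Unset Printing Implicit Defensive.
Import Order.TTheory GRing.Theory Num.Theory.
Import numFieldNormedType.Exports.
Local Open Scope classical_set_scope.
Local Open Scope ring_scope.

(* A real Hilbert space is a complete normed module [X] over [R : realType]
   together with a symmetric positive definite form [dot] inducing its norm. *)
Definition induces_norm (R : realType) (X : completeNormedModType R)
    (dot : {dot X for idfun}) : Prop :=
  forall x : X, dot x x = `|x| ^+ 2.

Section ConvexAnalysis.
Context {R : realType} {X : completeNormedModType R}.
Implicit Types (f g : X -> \bar R) (x y u v : X).
Local Open Scope ereal_scope.

Definition dom f : set X := [set x | f x < +oo].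

Definition inf_value f : \bar R := ereal_inf (range f).

Definition argmin f : set X := [set x | forall u, f x <= f u].

Definition bounded_below f : Prop := exists m : R, forall x, m%:E <= f x.

Definition proper_function f : Prop :=
  (forall x, f x != -oo) /\ (exists x, f x < +oo).

Definition convexe f : Prop :=
  forall (x y : X) (t : R), (0 < t < 1)%R ->
    f (t *: x + (1 - t) *: y)%R <= t%:E * f x + (1 - t)%:E * f y.

Definition Gamma0 f : Prop := [/\ proper_function f, convexe f & lower_semicontinuous f].

Definition domstar f : set X := dom f `\` argmin f.

(* The argmin is a singleton when [0 < lambda] and [Gamma0 g], so the default
   value [0] is then irrelevant. *)
Definition prox (lambda : R) g x : X :=
  xget 0%R (argmin (fun u => g u + ((2 * lambda)^-1 * `|u - x| ^+ 2)%:E)).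

(* The Riesz representative of the Frechet differential; it exists and is
   unique wherever [h] is differentiable, so the default value [0] is then
   irrelevant. *)
Definition gradient (dot : {dot X for idfun}) (h : X -> R) x : X :=
  xget 0%R [set v | forall u, 'd h x u = dot v u].

Definition subdifferential (dot : {dot X for idfun}) f x : set X :=
  [set v | forall u, f x + (dot v (u - x)%R)%:E <= f u].

(* [+oo] when the subdifferential is empty, since [ereal_inf set0 = +oo]. *)
Definition slope (dot : {dot X for idfun}) f x : \bar R :=
  ereal_inf [set `|v|%:E | v in subdifferential dot f x].

Definition lojasiewicz (dot : {dot X for idfun}) (p c : R) (Omega : set X) f
    : Prop :=
  (0 < c)%R /\
  forall x, (Omega `&` domstar f) x ->
    (f x - inf_value f) `^ (1 - p^-1) <= c%:E * slope dot f x.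

End ConvexAnalysis.

(* [a `^ s], except that [0 `^ s = +oo] for [s < 0] (the library has
   [0 `^ s = 0] there). *)
Definition xpow (R : realType) (a s : R) : \bar R :=
  if (a == 0) && (s < 0) then +oo%E else (a `^ s)%:E.

Definition is_maximum (R : realType) (A : set R) (m : R) : Prop :=
  A m /\ ubound A m.

(* Main.v *)
Require Import Defs.
From HB Require Import structures.
From mathcomp Require Import all_boot all_order all_algebra.
From mathcomp Require Import all_classical all_reals all_analysis.
From mathcomp Require Import ring lra.
Set Implicit Arguments.
Unset Strict Implicit.
Unset Printing Implicit Defensive.
Import Order.TTheory GRing.Theory Num.Theory.
Import numFieldNormedType.Exports.
Local Open Scope classical_set_scope.
Local Open Scope ring_scope.

(** A forward-backward step decreases [f] by at least [kappa] times a power of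
    the new gap, and a real sequence that obeys such a recursion decays
    polynomially.

    One step.  Write [x'] for the successor of [x] and [G] for the gradient of
    [h].  Optimality in the proximal problem says that
    [lambda^-1 *: (x - x') - G x] is a subgradient of [g] at [x'].  Testing it
    at [x], and bounding [h] above by its quadratic model of curvature [L],
    gives [f x' + (2 - lambda L) / (2 lambda) |x - x'|^2 <= f x]
    ([forward_backward_descent]).  Adding [G x'] instead turns it into a
    subgradient [v] of [f] at [x'], and [|v| <= |x - x'| / lambda] because
    [u - lambda *: G u] is nonexpansive: this is where the cocoercivity of [G]
    (Baillon-Haddad) is used, and it gives [kappa] its value.  The
    Lojasiewicz inequality at [x'] bounds the gap [r' = f x' - inf f] by [v].
    With [gam = (p - 2) / p > 0], so that [gam + 1 = 2 (1 - 1/p)], the two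
    estimates combine into [kappa r'^(gam + 1) <= r - r']
    ([forward_backward_decay]).

    The recursion.  It suffices that [r_n^(-gam)] grow at least linearly in
    [n].  Fix a threshold [s >= 1].  If [r^(gam + 1) <= s r'^(gam + 1)], the
    tangent line of [t^(-gam)] at [r] bounds the increment of [r^(-gam)] below
    by [gam kappa / s].  Otherwise the gap has dropped by a fixed factor, and
    since [r <= r_0] the increment is at least
    [r_0^(-gam) (s^(gam / (gam + 1)) - 1)] ([inverse_power_increment]).  The
    constant to be attained is a lower bound for the smaller of the two
    ([optimized_le_increment]); its maximum over [s] is reached where a
    decreasing and an increasing function of [s] cross.  If [f (x 0)] is
    infinite, the same argument runs from [x 1], where [f] is finite.

    Foundations.  The proximal objective [g + q |. - y|^2] has a minimizer, since
    strong convexity makes its sublevel sets near the infimum shrink; and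
    comparing that minimizer with points of a segment yields the subgradient
    above.  Applied to minus a continuous linear form, these two facts are the
    Riesz representation theorem, which makes the gradient meaningful. *)

(** * Hilbert space identities *)

Section InnerProduct.
Context {R : realType} {X : completeNormedModType R} (dot : {dot X for idfun}).
Implicit Types u v w : X.

Lemma dotC u v : dot u v = dot v u.
Proof. by rewrite hermC /= expr0 mul1r. Qed.

Lemma dotDl u v w : dot (u + v) w = dot u w + dot v w.
Proof. exact: linearDl. Qed.

Lemma dotDr u v w : dot u (v + w) = dot u v + dot u w.
Proof. exact: linearDr. Qed.

Lemma dotNl u v : dot (- u) v = - dot u v.
Proof. exact: linearNl. Qed.

Lemma dotNr u v : dot u (- v) = - dot u v.
Proof. exact: linearNr. Qed.

Lemma dotZl a u v : dot (a *: u) v = a * dot u v.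
Proof. exact: linearZl_LR. Qed.

Lemma dotZr a u v : dot u (a *: v) = a * dot u v.
Proof. by rewrite dotC dotZl dotC. Qed.

Definition dotE := (dotDl, dotDr, dotNl, dotNr, dotZl, dotZr).

End InnerProduct.

(** * Convex lower semicontinuous functions *)

Section Gamma0Theory.
Context {R : realType} {X : completeNormedModType R}.
Implicit Types (g : X -> \bar R) (u v y z : X).

Lemma segmentE (t : R) u v : t *: u + (1 - t) *: v = v + t *: (u - v).
Proof. by rewrite scalerBl scale1r scalerBr addrCA. Qed.

Lemma convexe_fin g u v a b (t : R) : convexe g -> 0 < t < 1 ->
  g u = a%:E -> g v = b%:E ->
  (g (t *: u + (1 - t) *: v)%R <= (t * a + (1 - t) * b)%:E)%E.
Proof. by move=> cg t01 gu gv; have := cg u v t t01; rewrite gu gv. Qed.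

(** Lower semicontinuity bounds [g] below on a ball around a point of the
    domain; convexity along segments from that point propagates the bound
    outwards with a linear loss.  This does the work of a continuous affine
    minorant without separating convex sets. *)
Lemma Gamma0_lower_bound g : Gamma0 g ->
  exists (x0 : X) (b K : R), 0 < K /\
    forall u, ((b - K * `|u - x0|)%:E <= g u)%E.
Proof.
case=> -[gNy [x0 gx0]] cg lg.
have [b gb] : exists b : R, g x0 = b%:E.
  by case: (g x0) (gNy x0) gx0 => [b _ _|//|//]; exists b.
have [|V /nbhs_ballP[d /= d0 dV] Vg] := lg x0 (b - 1).
  by rewrite gb lte_fin; lra.
exists x0, (b - 1), (2 / d); split; first by rewrite divr_gt0.
move=> u; have [ux|ux] := ltP `|u - x0| d.
  apply/ltW/(@le_lt_trans _ _ (b - 1)%:E).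
    by rewrite lee_fin lerBlDr lerDl mulr_ge0 // divr_ge0 // ltW.
  by apply: Vg; apply: dV; rewrite -ball_normE /= distrC.
case gu : (g u) => [a||]; last 2 first.
- by rewrite leey.
- by have := gNy u; rewrite gu.
(* the point of parameter [t] on the segment from [x0] to [u] is at distance
   [d / 2] from [x0] *)
pose N := `|u - x0|; have N0 : 0 < N by apply: lt_le_trans ux.
pose t := d / (2 * N).
have t0 : 0 < t by rewrite divr_gt0 ?mulr_gt0.
have tN : t * N = d / 2 by rewrite /t; field; rewrite ?gt_eqF.
have t1 : t < 1 by rewrite -/N in ux; rewrite ltr_pdivrMr ?mulr_gt0//; lra.
have yb : V (t *: u + (1 - t) *: x0).
  apply: dV; rewrite -ball_normE /=.
  rewrite segmentE opprD addrA addrN add0r.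
  rewrite normrN normrZ gtr0_norm // -/N tN; lra.
have t01 : 0 < t < 1 by rewrite t0 t1.
have := lt_le_trans (Vg _ yb) (convexe_fin cg t01 gu gb).
rewrite lte_fin lee_fin => H.
have -> : 2 / d * `|u - x0| = t^-1.
  by rewrite -/N /t; field; rewrite !gt_eqF.
have : b - a < t^-1 by rewrite -[t^-1]mul1r ltr_pdivlMr //; lra.
lra.
Qed.

End Gamma0Theory.

(** * Proximal points *)

Section Hilbert.
Context {R : realType} {X : completeNormedModType R} (dot : {dot X for idfun}).
Context (hdot : induces_norm dot).
Implicit Types (g : X -> \bar R) (u v y z : X).

Lemma sqr_normD u v : `|u + v| ^+ 2 = `|u| ^+ 2 + `|v| ^+ 2 + 2 * dot u v.
Proof. by rewrite -!hdot !dotE (dotC _ v u); ring. Qed.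

Lemma sqr_normB u v : `|u - v| ^+ 2 = `|u| ^+ 2 + `|v| ^+ 2 - 2 * dot u v.
Proof. by rewrite -!hdot !dotE (dotC _ v u); ring. Qed.

Lemma sqr_norm_segment (t : R) u v y :
  `|t *: u + (1 - t) *: v - y| ^+ 2 =
  t * `|u - y| ^+ 2 + (1 - t) * `|v - y| ^+ 2 - t * (1 - t) * `|u - v| ^+ 2.
Proof.
rewrite -!hdot !dotE (dotC _ v u) (dotC _ y u) (dotC _ y v); ring.
Qed.

(** The objective of the proximal problem at [y]; the prox of [lambda] takes
    [q = (2 * lambda)^-1]. *)
Definition prox_objective g (q : R) y u : \bar R := (g u + (q * `|u - y| ^+ 2)%:E)%E.

Lemma prox_objective_strongly_convex g (q : R) y u v a b (t : R) :
  convexe g -> 0 < t < 1 ->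
  prox_objective g q y u = a%:E -> prox_objective g q y v = b%:E ->
  (prox_objective g q y (t *: u + (1 - t) *: v)%R <=
   (t * a + (1 - t) * b - q * (t * (1 - t) * `|u - v| ^+ 2))%:E)%E.
Proof.
move=> cg t01; rewrite /prox_objective.
case gu : (g u) => [a'||] // [<-]; case gv : (g v) => [b'||] // [<-].
rewrite sqr_norm_segment.
apply: (@le_trans _ _ ((t * a' + (1 - t) * b')%:E + _)%E).
  by apply: leeD2r; exact: convexe_fin cg t01 gu gv.
by rewrite -EFinD lee_fin le_eqVlt; apply/orP; left; apply/eqP; ring.
Qed.

Lemma prox_objective_fin g (q : R) y u : Gamma0 g -> (prox_objective g q y u < +oo)%E ->
  exists a : R, prox_objective g q y u = a%:E.
Proof.
case=> -[gNy _] _ _; rewrite /prox_objective; case gu : (g u) => [a||] //.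
  by move=> _; exists (a + q * `|u - y| ^+ 2).
by have := gNy u; rewrite gu.
Qed.

Lemma prox_objective_lower_bound g (q : R) y : Gamma0 g -> 0 < q ->
  exists m : R, forall u, (m%:E <= prox_objective g q y u)%E.
Proof.
move=> /Gamma0_lower_bound[x0 [b [K [K0 bg]]]] q0.
exists (b - K * `|x0 - y| - K ^+ 2 / (4 * q)) => u.
apply: (@le_trans _ _ (b - K * `|u - x0| + q * `|u - y| ^+ 2)%:E); last first.
  by rewrite EFinD leeD2r.
rewrite lee_fin.
have tri : `|u - x0| <= `|u - y| + `|x0 - y|.
  by rewrite (distrC x0); exact: ler_distD.
have Ktri : K * `|u - x0| <= K * `|u - y| + K * `|x0 - y|.
  by rewrite -mulrDr ler_pM2l.
(* completing the square in the distance from [u] to [y] *)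
have : 0 <= q * (`|u - y| - K / (2 * q)) ^+ 2 by rewrite mulr_ge0 ?sqr_ge0 ?ltW.
have -> : q * (`|u - y| - K / (2 * q)) ^+ 2 =
  q * `|u - y| ^+ 2 - K * `|u - y| + K ^+ 2 / (4 * q).
  by field; rewrite gt_eqF.
lra.
Qed.

(** By strong convexity the sets where the objective is within [e] of its
    infimum have diameter of order [sqrt e], so they generate a Cauchy filter;
    lower semicontinuity makes its limit a minimizer. *)
Lemma argmin_prox_objective_nonempty g (q : R) y : Gamma0 g -> 0 < q ->
  exists z, argmin (prox_objective g q y) z.
Proof.
move=> Gg q0; have [[gNy [x1 gx1]] cg lg] := Gg.
pose G := prox_objective g q y.
have [c0 c0G] := prox_objective_lower_bound y Gg q0.
have [b Gb] : exists b : R, G x1 = b%:E.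
  apply: prox_objective_fin Gg _; rewrite /prox_objective.
  by case: (g x1) (gNy x1) gx1 => [r _ _|//|//]; rewrite -EFinD ltry.
have [m im] : exists m : R, ereal_inf (range G) = m%:E.
  have lo : (c0%:E <= ereal_inf (range G))%E.
    by apply: le_ereal_inf_tmp => _ [u _ <-]; exact: c0G.
  have up : (ereal_inf (range G) <= b%:E)%E.
    by rewrite -Gb; apply: ereal_inf_lbound; exists x1.
  case: (ereal_inf (range G)) lo up => [r _ _|//|//]; by exists r.
have mG u : (m%:E <= G u)%E.
  by rewrite -im; apply: ereal_inf_lbound; exists u.
(* near-minimizers; taking midpoints bounds the diameter of [S e] *)
pose S (e : R) : set X := [set u | (G u < (m + e)%:E)%E].
have S0 e : 0 < e -> exists u, S e u.
  move=> e0; have : (ereal_inf (range G) < (m + e)%:E)%E.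
    by rewrite im lte_fin ltrDl.
  by move=> /ereal_inf_lt[_ [u _ <-] ?]; exists u.
have SS e u v : S e u -> S e v -> q * `|u - v| ^+ 2 <= 4 * e.
  move=> Su Sv.
  have [a Ga] := prox_objective_fin Gg (lt_trans Su (ltry _)).
  have [d Gd] := prox_objective_fin Gg (lt_trans Sv (ltry _)).
  have h01 : 0 < (2^-1 : R) < 1 by lra.
  have := le_trans (mG _) (prox_objective_strongly_convex cg h01 Ga Gd).
  move: Su Sv; rewrite /S /= /G Ga Gd !lte_fin lee_fin; lra.
pose F : set_system X := filter_from [set e : R | 0 < e] S.
have PF : ProperFilter F.
  apply: filter_from_proper; last by move=> e /S0.
  apply: filter_from_filter; first by exists 1 => /=.
  move=> e1 e2 /= e10 e20; exists (Num.min e1 e2).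
    by rewrite /= lt_min e10 e20.
  by move=> u Su; split; apply: (lt_le_trans Su);
    rewrite lee_fin lerD2l ge_min lexx ?orbT.
have FS e : 0 < e -> F (S e) by move=> e0; exists e.
have cF : cauchy F.
  apply: cauchy_exP => e e0.
  pose e' := q * e ^+ 2 / 8.
  have e'0 : 0 < e' by rewrite divr_gt0 ?mulr_gt0 ?exprn_gt0.
  have [u Su] := S0 _ e'0; exists u; exists e' => // v Sv.
  rewrite -ball_normE /= -(@ltr_pXn2r _ 2%N) ?nnegrE // ?ltW //.
  rewrite -(ltr_pM2l q0); apply: le_lt_trans (SS _ _ _ Su Sv) _.
  have : 0 < q * e ^+ 2 by rewrite mulr_gt0 ?exprn_gt0.
  by rewrite /e'; lra.
have cvF : F --> lim F by exact: cauchy_cvg.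
set z := lim F in cvF.
exists z => u; apply: le_trans (mG u).
rewrite leNgt; apply/negP => mz.
(* lower semicontinuity would keep [G] away from its infimum near [z] *)
have [e e0 me] : exists2 e : R, 0 < e &
    ((m + 2 * e - q * `|z - y| ^+ 2)%:E < g z)%E.
  move: mz; rewrite /prox_objective; case: (g z) => [a| |] //.
    rewrite -EFinD lte_fin => ma.
    exists ((a + q * `|z - y| ^+ 2 - m) / 4); first lra.
    by rewrite lte_fin; lra.
  by move=> _; exists 1 => //; rewrite ltry.
have [V Vz Vg] := lg _ _ me.
have Vq : nbhs z [set v | q * `|z - y| ^+ 2 - e < q * `|v - y| ^+ 2].
  have : (fun v => q * `|v - y| ^+ 2) v @[v --> z] --> q * `|z - y| ^+ 2.
    apply: cvgM; first exact: cvg_cst.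
    by apply: cvgM; apply: cvg_norm; apply: cvgB;
      [exact: cvg_id|exact: cvg_cst|exact: cvg_id|exact: cvg_cst].
  by move=> /cvgr_gt; apply; lra.
have [v [[Vv vq] Sv]] := @filter_ex _ F _ _
  (filterI (filterI (cvF _ Vz) (cvF _ Vq)) (FS _ e0)).
have := Vg _ Vv; move: Sv vq; rewrite /S /G /prox_objective /=.
by case: (g v) => [a| |] //; rewrite -EFinD !lte_fin; lra.
Qed.

Lemma ge0_affine_limit (a b : R) :
  (forall t, 0 < t < 1 -> 0 <= a + t * b) -> 0 <= a.
Proof.
move=> ab; rewrite leNgt; apply/negP => a0.
(* small enough for [t * b] not to compensate half of the negative [a] *)
pose t := - a / (2 * (`|b| + - a)).
have b0 := normr_ge0 b.
have D0 : 0 < 2 * (`|b| + - a) by lra.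
have t0 : 0 < t by rewrite divr_gt0 // oppr_gt0.
have t1 : t < 1 by rewrite ltr_pdivrMr //; lra.
have := ab t; rewrite t0 t1 => /(_ isT).
have : t * b <= t * `|b| by rewrite ler_pM2l // ler_norm.
have : t * `|b| = - a / 2 - t * - a by rewrite /t; field; rewrite gt_eqF //; lra.
have : 0 < t * - a by rewrite mulr_gt0 // oppr_gt0.
lra.
Qed.

Lemma argmin_prox_objective_fin g (q : R) y z : Gamma0 g ->
  argmin (prox_objective g q y) z -> exists b : R, g z = b%:E.
Proof.
case=> -[gNy [x1 gx1]] _ _ /(_ x1); rewrite /prox_objective.
case: (g z) (gNy z) => [b||] //; first by exists b.
by case: (g x1) (gNy x1) gx1.
Qed.

(** Compare the minimizer [z] with [z + t (u - z)]: strong convexity gives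
    [g z + q |z - y|^2 + q (1 - t) |u - z|^2 <= g u + q |u - y|^2], and
    expanding the squares as [t] tends to [0] leaves the subgradient
    inequality. *)
Lemma argmin_prox_objective_subdifferential g (q : R) y z : Gamma0 g ->
  argmin (prox_objective g q y) z -> subdifferential dot g z ((2 * q) *: (y - z)).
Proof.
move=> Gg zmin u; have [[gNy _] cg _] := Gg.
have [b gz] := argmin_prox_objective_fin Gg zmin.
case gu : (g u) => [a||]; last 2 first.
- by rewrite leey.
- by have := gNy u; rewrite gu.
have Gu : prox_objective g q y u = (a + q * `|u - y| ^+ 2)%:E.
  by rewrite /prox_objective gu.
have Gz : prox_objective g q y z = (b + q * `|z - y| ^+ 2)%:E.
  by rewrite /prox_objective gz.
rewrite gz -EFinD lee_fin -subr_ge0.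
apply: (@ge0_affine_limit _ (q * `|u - z| ^+ 2)) => t t01.
have := le_trans (zmin _) (prox_objective_strongly_convex cg t01 Gu Gz).
rewrite Gz lee_fin => H.
have {}H : 0 <= t * (a + q * `|u - y| ^+ 2 - (b + q * `|z - y| ^+ 2)
   - q * (1 - t) * `|u - z| ^+ 2) by lra.
move: t01 => /andP[t0 _]; move: H; rewrite pmulr_rge0 //.
have -> : u - y = (u - z) + (z - y) by rewrite addrA subrK.
rewrite sqr_normD dotZl.
have -> : dot (u - z) (z - y) = - dot (y - z) (u - z).
  by rewrite dotC -dotNl opprB.
lra.
Qed.

Lemma lower_semicontinuous_EFin (f : X -> R) :
  continuous f -> lower_semicontinuous (fun u => (f u)%:E).
Proof.
move=> cf u a; rewrite lte_fin => au; exists [set v | a < f v] => //.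
exact: (cvgr_gt _ (cf u)).
Qed.

(** * Gradients of smooth convex functions *)

(** The minimizer [z] of [|u|^2 - phi u] represents [phi] up to the factor 2,
    because minus [phi] being linear, a subgradient inequality for it is an
    equality. *)
Lemma riesz_representation (phi : {linear X -> R^o}) : continuous phi ->
  exists v : X, forall u, phi u = dot v u.
Proof.
move=> cphi.
pose g (u : X) : \bar R := (- phi u : R)%:E.
have Gg : Gamma0 g.
  split.
  - by split=> [u|] //; exists 0; rewrite ltry.
  - move=> u v t _; rewrite /g linearD !linearZ -!EFinM -EFinD lee_fin.
    by rewrite /GRing.scale /= opprD !mulrN.
  - by apply: lower_semicontinuous_EFin => u; apply: cvgN; exact: cphi.
have [z zmin] := argmin_prox_objective_nonempty 0 Gg (ltr01 : 0 < (1 : R)).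
have /argmin_prox_objective_subdifferential := zmin => /(_ Gg) zsub.
have le_phi u : phi u <= dot ((2 * 1) *: z) u.
  have := zsub (z + u); rewrite /g [z + u]addrC addrK sub0r -EFinD lee_fin.
  rewrite linearD /= opprD !dotE; lra.
exists ((2 * 1) *: z) => u; apply/eqP; rewrite eq_le le_phi /=.
by have := le_phi (- u); rewrite linearN dotNr lerN2.
Qed.

Lemma gradientP (h : X -> R) x : differentiable h x ->
  forall u, 'd h x u = dot (gradient dot h x) u.
Proof.
move=> dh.
have [v hv] := riesz_representation (diff_continuous dh).
rewrite /gradient.
by apply: (@xgetPex _ _ [set v | forall u, 'd h x u = dot v u]); exists v.
Qed.

Lemma convex_functionE (h : X -> R) u v (t : R) :
  convex_function [set: convex_lmodType X] h -> 0 < t < 1 ->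
  h (t *: u + (1 - t) *: v) <= t * h u + (1 - t) * h v.
Proof.
move=> ch /andP[t0 t1].
pose ti : {i01 R} := Itv01 (ltW t0) (ltW t1).
have := ch ti u v; rewrite !inE => /(_ I I).
by rewrite !convRE.
Qed.

Lemma gradient_le (h : X -> R) x u :
  convex_function [set: convex_lmodType X] h -> differentiable h x ->
  h x + dot (gradient dot h x) (u - x) <= h u.
Proof.
move=> ch dh; rewrite -gradientP // -deriveE //.
rewrite addrC -lerBrDr.
have cvD : (fun t => t^-1 *: ((h \o shift x) (t *: (u - x)) - h x)) @ 0^'
   --> 'D_(u - x) h x by exact: (@diff_derivable _ _ _ h x (u - x) dh).
apply: (cvgr_to_le (cvg_dnbhs_at_right cvD)).
near=> t; have t0 : 0 < t by near: t; exact: nbhs_right_gt.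
have t01 : 0 < t < 1 by rewrite t0 /=; near: t; exact: nbhs_right_lt.
rewrite /GRing.scale /= ler_pdivrMl //.
have := convex_functionE u x ch t01.
rewrite segmentE [x + _]addrC; lra.
Unshelve. all: by end_near. Qed.

Lemma dot_le u v : dot u v <= `|u| * `|v|.
Proof.
have [u0|u0] := eqVneq u 0; first by rewrite u0 dotC -(scale0r 0) dotZr mul0r mulr_ge0.
have [v0|v0] := eqVneq v 0; first by rewrite v0 -(scale0r 0) dotZr mul0r mulr_ge0.
have uv0 : 0 < 2 * (`|u| * `|v|) by rewrite !mulr_gt0 ?normr_gt0.
rewrite -(ler_pM2l uv0) -subr_ge0.
apply: le_trans (sqr_ge0 `| `|v| *: u - `|u| *: v |) _.
rewrite sqr_normB !normrZ !normr_id !dotE; lra.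
Qed.

Section SmoothConvex.
Context (h : X -> R) (G : X -> X) (L : R) (L0 : 0 < L).
Context (hG : forall x u, h x + dot (G x) (u - x) <= h u).
Context (GL : forall x y, `|G x - G y| <= L * `|x - y|).

Let bregman x y := h y - h x - dot (G x) (y - x).

(** Splitting a segment at its midpoint: two half-length gaps cost [K / 2] in
    total, and the change of gradient at the midpoint costs [L / 4]. *)
Lemma bregman_halving K : (forall x y, bregman x y <= K * `|y - x| ^+ 2) ->
  forall x y, bregman x y <= (K / 2 + L / 4) * `|y - x| ^+ 2.
Proof.
move=> HK x y; pose d := 2^-1 *: (y - x); pose m := x + d.
have dd : y - x = d + d by rewrite -scalerDl -[2^-1]mul1r -splitr scale1r.
have mx : m - x = d by rewrite /m addrC addKr.
have ym : y - m = d by rewrite /m opprD addrA dd addrK.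
have := HK x m; have := HK m y.
rewrite /bregman mx ym dd !dotE -[d + d]mulr2n normrMn.
have : dot (G m - G x) d <= L * `|d| ^+ 2.
  apply: le_trans (dot_le _ _) _; rewrite expr2 mulrA ler_wpM2r //.
  by rewrite -mx.
rewrite !dotE; lra.
Qed.

(** The constant [L] is immediate from convexity at [y]; [K / 2 + L / 4] has the
    fixed point [L / 2], and halving repeatedly drives the constant to it. *)
Lemma quadratic_upper_model x y :
  h y <= h x + dot (G x) (y - x) + L / 2 * `|y - x| ^+ 2.
Proof.
have H n : forall x y, bregman x y <=
    (L / 2 + L / 2 * (2^-1) ^+ n) * `|y - x| ^+ 2.
  elim: n => [|n IH] {}x {}y.
    rewrite expr0 mulr1 -splitr expr2 mulrA.
    apply: (@le_trans _ _ (dot (G y - G x) (y - x))).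
      have := hG y x; rewrite /bregman -[x - y]opprB !dotE; lra.
    by apply: le_trans (dot_le _ _) _; rewrite ler_wpM2r.
  apply: le_trans (bregman_halving IH x y) _.
  by rewrite [_ ^+ n.+1]exprS; lra.
suff : bregman x y <= L / 2 * `|y - x| ^+ 2 by rewrite /bregman; lra.
have cv : (fun n => (L / 2 + L / 2 * (2^-1) ^+ n) * `|y - x| ^+ 2) @ \oo -->
    (L / 2 + L / 2 * 0) * `|y - x| ^+ 2.
  apply: cvgMr_tmp; apply: cvgD; first exact: cvg_cst.
  by apply: cvgMl_tmp; apply: cvg_expr; rewrite ger0_norm ?invr_ge0 // invf_lt1 ?ltr1n.
rewrite -[L / 2]addr0 -(mulr0 (L / 2)).
by apply: (cvgr_to_ge cv); near=> n; exact: H.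
Unshelve. all: by end_near. Qed.

(** The function [h - dot (G x)] is minimal at [x]; compare [x] with the point
    [z] reached from [y] by a gradient step of length [L^-1] on that function,
    which is the minimizer of its quadratic upper model at [y]. *)
Lemma gradient_gap x y :
  h x + dot (G x) (y - x) + (2 * L)^-1 * `|G y - G x| ^+ 2 <= h y.
Proof.
have [e eE] : exists e, e = G y - G x by exists (G y - G x).
pose z := y - L^-1 *: e.
have := hG x z; have := quadratic_upper_model y z.
have -> : z - y = - (L^-1 *: e) by rewrite /z addrAC subrr sub0r.
have -> : z - x = (y - x) - L^-1 *: e by rewrite /z addrAC.
rewrite normrN normrZ gtr0_norm ?invr_gt0 // -eE !dotE.
have -> : L / 2 * (L^-1 * `|e|) ^+ 2 = (2 * L)^-1 * `|e| ^+ 2.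
  by field; rewrite gt_eqF.
have : L^-1 * dot (G y) e - L^-1 * dot (G x) e = 2 * ((2 * L)^-1 * `|e| ^+ 2).
  by rewrite -mulrBr -dotNl -dotDl -eE hdot; field; rewrite gt_eqF.
lra.
Qed.

(** Baillon-Haddad theorem: add the previous inequality to itself with [x] and
    [y] exchanged. *)
Lemma cocoercive x y :
  `|G x - G y| ^+ 2 <= L * dot (G x - G y) (x - y).
Proof.
have := gradient_gap x y; have := gradient_gap y x.
rewrite [`|G y - G x|]distrC -[y - x]opprB => H1 H2.
have : 2 * ((2 * L)^-1 * `|G x - G y| ^+ 2) <= dot (G x - G y) (x - y).
  by move: H1 H2; rewrite !dotE; lra.
have -> : 2 * ((2 * L)^-1 * `|G x - G y| ^+ 2) = `|G x - G y| ^+ 2 / L.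
  by field; rewrite gt_eqF.
by rewrite ler_pdivrMr // mulrC.
Qed.

Lemma gradient_step_nonexpansive (lambda : R) x y : 0 < lambda < 2 / L ->
  `|(x - y) - lambda *: (G x - G y)| <= `|x - y|.
Proof.
move=> /andP[l0 lL].
rewrite -(@ler_pXn2r _ 2%N) ?nnegrE // sqr_normB normrZ gtr0_norm // dotZr.
have := cocoercive x y; rewrite dotC; set a := `|G x - G y| ^+ 2 => H.
have lL2 : lambda * L <= 2 by rewrite -ler_pdivlMr // ltW.
have : 0 <= dot (x - y) (G x - G y).
  by rewrite -(pmulr_rge0 _ L0); apply: le_trans H; rewrite sqr_ge0.
rewrite exprMn -/a; set b := dot _ _ in H *.
move=> b0.
have : lambda * (lambda * a) <= lambda * (2 * b).
  rewrite ler_pM2l //; apply: (@le_trans _ _ (lambda * (L * b))).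
    by rewrite ler_pM2l.
  by rewrite mulrA ler_wpM2r.
rewrite expr2; lra.
Qed.

End SmoothConvex.

End Hilbert.

(** * Polynomial decay of real sequences *)

Section RealSequences.
Context {R : realType}.
Implicit Types a b s kappa gam : R.

(** The tangent at [a] lies below the graph of [t `^ (- gam)].  After division
    by [a `^ (- gam)] this follows from [1 + x <= expR x] and [ln y <= y - 1]. *)
Lemma powRN_tangent gam a b : 0 < gam -> 0 < b -> b <= a ->
  gam * (a - b) * a `^ (- (gam + 1)) <= b `^ (- gam) - a `^ (- gam).
Proof.
move=> gam0 b0 ba; have a0 : 0 < a by apply: lt_le_trans ba.
pose y := b / a; have y0 : 0 < y by rewrite divr_gt0.
have bE : b = a * y by rewrite /y mulrCA divff ?mulr1 // gt_eqF.
have apos : 0 < a `^ (- gam) by rewrite powR_gt0.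
have -> : a `^ (- (gam + 1)) = a `^ (- gam) / a.
  by rewrite opprD powRD ?(gt_eqF a0) ?implybT // powR_inv1 // ltW.
have -> : b `^ (- gam) = a `^ (- gam) * y `^ (- gam).
  by rewrite bE powRM // ltW.
have -> : gam * (a - b) * (a `^ (- gam) / a) = a `^ (- gam) * (gam * (1 - y)).
  by rewrite bE; field; rewrite gt_eqF.
rewrite -{3}[a `^ _]mulr1 -mulrBr ler_pM2l //.
have : 1 + - gam * ln y <= y `^ (- gam) by rewrite /powR gt_eqF // expR_ge1Dx.
have : gam * ln y <= gam * (y - 1).
  rewrite ler_pM2l //; have := le_ln1Dx.
  by rewrite -[y in ln y](subrKC 1); apply; lra.
lra.
Qed.

(** Two regimes, separated by the threshold [s].  In a short step [a] and [b]
    are comparable and the tangent line turns the decrease [a - b] into a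
    growth of the inverse power.  In a long step [b] is smaller than [a] by a
    factor depending on [s] only, so the inverse power grows by a fixed
    proportion of itself, hence of its value at [r0]. *)
Lemma inverse_power_increment kappa gam s a b r0 : 0 < kappa -> 0 < gam ->
  1 <= s -> 0 < b -> b <= a -> a <= r0 ->
  kappa * b `^ (gam + 1) <= a - b ->
  Num.min (gam * kappa / s) (r0 `^ (- gam) * (s `^ (gam / (gam + 1)) - 1))
    <= b `^ (- gam) - a `^ (- gam).
Proof.
move=> k0 gam0 s1 b0 ba ar0 kab.
have a0 : 0 < a by apply: lt_le_trans ba.
have s0 : 0 < s by apply: lt_le_trans s1.
have g10 : 0 < gam + 1 by lra.
have ab0 : 0 < a `^ (gam + 1) by rewrite powR_gt0.
have bb0 : 0 < b `^ (gam + 1) by rewrite powR_gt0.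
rewrite ge_min; have [short|long] := leP (a `^ (gam + 1)) (s * b `^ (gam + 1)).
  apply/orP; left; apply: le_trans (powRN_tangent gam0 b0 ba).
  rewrite powRN ler_pdivlMr // mulrAC ler_pdivrMr // -!mulrA ler_pM2l //.
  apply: (@le_trans _ _ (kappa * (s * b `^ (gam + 1)))).
    by rewrite ler_pM2l.
  by rewrite mulrCA mulrC ler_pM2r.
apply/orP; right.
have r00 : 0 < r0 by apply: lt_le_trans ar0.
have pw (t : R) : 0 < t -> (t `^ (gam + 1)) `^ (gam / (gam + 1)) = t `^ gam.
  by move=> t0; rewrite -powRrM mulrC divfK ?gt_eqF.
have w1 : 1 <= s `^ (gam / (gam + 1)).
  by rewrite -[leLHS](powRr0 s) ler_powR // divr_ge0 // ltW.
have : s `^ (gam / (gam + 1)) * b `^ gam <= a `^ gam.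
  rewrite -(pw b) // -(pw a) // -powRM ?(ltW s0) ?(ltW bb0) //.
  by rewrite ge0_ler_powR ?nnegrE ?divr_ge0 ?mulr_ge0 // ltW.
have : a `^ gam <= r0 `^ gam by rewrite ge0_ler_powR ?nnegrE // ltW.
rewrite !powRN.
have : 0 < a `^ gam by rewrite powR_gt0.
have : 0 < b `^ gam by rewrite powR_gt0.
have : 0 < r0 `^ gam by rewrite powR_gt0.
move: (s `^ _) w1 (a `^ gam) (b `^ gam) (r0 `^ gam) => w w1 A B C C0 B0 A0 AC wBA.
apply: (@le_trans _ _ (A^-1 * (w - 1))).
  by rewrite ler_wpM2r ?subr_ge0 // lef_pV2.
rewrite mulrBr mulr1 lerD2r mulrC ler_pdivrMr // mulrC ler_pdivlMr //.
Qed.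

Section Recursion.
Context (r : nat -> R) (kappa gam : R).
Context (k0 : 0 < kappa) (gam0 : 0 < gam).
Context (decay : forall n, kappa * r n.+1 `^ (gam + 1) <= r n - r n.+1).

Lemma decay_antitone n : r n.+1 <= r n.
Proof.
by rewrite -subr_ge0; apply: le_trans (decay n); rewrite mulr_ge0 ?powR_ge0 ?ltW.
Qed.

Lemma decay_le0 n : r n <= r 0%N.
Proof. by elim: n => // n; apply: le_trans (decay_antitone n). Qed.

Lemma decay_growth s n : 1 <= s -> 0 < r n ->
  (r 0%N) `^ (- gam) + n%:R *
    Num.min (gam * kappa / s)
      (r 0%N `^ (- gam) * (s `^ (gam / (gam + 1)) - 1))
  <= r n `^ (- gam).
Proof.
move=> s1; elim: n => [|n IH] rn0; first by rewrite mul0r addr0.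
have rn := lt_le_trans rn0 (decay_antitone n).
have := inverse_power_increment k0 gam0 s1 rn0 (decay_antitone n) (decay_le0 n)
  (decay n).
have := IH rn; rewrite -[n.+1%:R]natr1 mulrDl mul1r; lra.
Qed.

End Recursion.

Lemma rate_of_inverse_power (x D gam : R) (n : nat) :
  0 <= x -> 0 < gam -> 0 < D -> (0 < n)%N ->
  (0 < x -> n%:R * D <= x `^ (- gam)) ->
  x <= (D^-1) `^ gam^-1 * n%:R `^ (- gam^-1).
Proof.
rewrite le_eqVlt => /predU1P[<-|x0] g0 D0 n0; first by rewrite mulr_ge0 ?powR_ge0.
have n0R : 0 < n%:R :> R by rewrite ltr0n.
move=> /(_ x0); rewrite powRN => H.
have {}H : x `^ gam <= D^-1 * n%:R^-1.
  rewrite -invfM mulrC -[x `^ gam]invrK lef_pV2 ?posrE ?invr_gt0 ?powR_gt0 //.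
  by rewrite mulr_gt0.
rewrite powRN -[(n%:R `^ _)^-1]powR_inv1 ?powR_ge0 // powRAC powR_inv1 ?(ltW n0R) //.
have Di0 : 0 <= D^-1 by rewrite invr_ge0 ltW.
have ni0 : 0 <= n%:R^-1 :> R by rewrite invr_ge0 ltW.
have -> : x = (x `^ gam) `^ gam^-1.
  by rewrite -powRrM divff ?gt_eqF // powRr1 // ltW.
by rewrite -powRM // ge0_ler_powR ?nnegrE ?powR_ge0 ?mulr_ge0 // invr_ge0 ltW.
Qed.

(** The first function decreases to [0] and the second increases from [0], so
    they cross, and their minimum is largest at the crossing. *)
Lemma max_min_crossing gam (k th : R) : 0 < gam -> 0 < k -> 0 < th ->
  let F := fun s : R => Num.min (gam / s) (k * (1 - s `^ (- th))) in
  exists2 s, 1 <= s & 0 < F s /\ forall t, 1 <= t -> F t <= F s.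
Proof.
move=> g0 k0 th0 F.
have incr s t : 1 <= s -> s <= t -> k * (1 - s `^ (- th)) <= k * (1 - t `^ (- th)).
  move=> s1 st; have s0 : 0 < s by apply: lt_le_trans s1.
  have t0 : 0 < t by apply: lt_le_trans st.
  rewrite ler_pM2l // lerD2l lerN2 !powRN lef_pV2 ?posrE ?powR_gt0 //.
  by rewrite ge0_ler_powR ?nnegrE // ltW.
have decr s t : 1 <= s -> s <= t -> gam / t <= gam / s.
  move=> s1 st; have s0 : 0 < s by apply: lt_le_trans s1.
  have t0 : 0 < t by apply: lt_le_trans st.
  by rewrite ler_pM2l // lef_pV2.
have B2 : 0 < k * (1 - 2 `^ (- th)).
  rewrite mulr_gt0 // subr_gt0 powRN invf_lt1 ?powR_gt0 //.
  have : (1 : R) `^ th < 2 `^ th by rewrite gt0_ltr_powR ?nnegrE ?ltr1n.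
  by rewrite powR1.
(* beyond [gam / b] the decreasing function is below [b], hence below the
   increasing one *)
set b := k * _ in B2.
pose S := Num.max 2 (gam / b).
have S2 : 2 <= S by rewrite le_max lexx.
have S1 : 1 <= S by lra.
have S0 : 0 < S by lra.
pose H (s : R) := gam / s - k * (1 - s `^ (- th)).
have H1 : 0 <= H 1 by rewrite /H powR1 subrr mulr0 subr0 divr1 ltW.
have HS : H S <= 0.
  rewrite /H subr_le0; apply: le_trans (incr 2 S _ S2); last lra.
  by rewrite ler_pdivrMr // mulrC -ler_pdivrMr // le_max lexx orbT.
have cH : {within `[1, S], continuous H}.
  apply: continuous_in_subspaceT => s; rewrite inE /= in_itv /= => /andP[s1 _].
  have s0 : 0 < s by apply: lt_le_trans s1.
  apply: cvgB.
    by apply: cvgM; [exact: cvg_cst|apply: cvgV; [rewrite gt_eqF|exact: cvg_id]].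
  apply: cvgM; first exact: cvg_cst.
  apply: cvgB; first exact: cvg_cst.
  apply: (@differentiable_continuous _ _ _ s (fun x : R => x `^ (- th))).
  apply/derivable1_diffP.
  by apply: derivable_powR; rewrite in_itv /= s0.
have [|c] := IVT S1 cH (v := 0).
  by rewrite ge_min le_max HS H1 orbT.
rewrite in_itv /= => /andP[c1 cS] /eqP; rewrite /H subr_eq0 => /eqP Hc.
have c0 : 0 < c by apply: lt_le_trans c1.
have Fc : F c = gam / c by rewrite /F -Hc minxx.
exists c => //; split; first by rewrite Fc divr_gt0.
move=> t t1; rewrite Fc /F ge_min; have [ct|tc] := leP c t.
  by rewrite decr.
by rewrite Hc orbC incr // ltW.
Qed.

End RealSequences.

Section Rates.
Context {R : realType} (kappa gam : R) (k0 : 0 < kappa) (gam0 : 0 < gam).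
Let th := gam / (gam + 1).

Let th0 : 0 < th. Proof. by rewrite divr_gt0 // addr_gt0. Qed.

(** The first factor is at most [kappa], which is what the short steps need, and
    at most [kappa `^ th], which the long steps cancel; for these,
    [1 - w^-1 <= w - 1] with [w = s `^ th]. *)
Lemma optimized_le_increment (r0 s : R) : 0 < r0 -> 1 <= s ->
  Num.min kappa (kappa `^ th) *
    Num.min (gam / s) (kappa `^ (- th) * r0 `^ (- gam) * (1 - s `^ (- th)))
  <= Num.min (gam * kappa / s) (r0 `^ (- gam) * (s `^ th - 1)).
Proof.
move=> r00 s1; have s0 : 0 < s by apply: lt_le_trans s1.
have kt0 : 0 < kappa `^ th by rewrite powR_gt0.
have r0g : 0 < r0 `^ (- gam) by rewrite powR_gt0.
have w1 : 1 <= s `^ th by rewrite -[leLHS](powRr0 s) ler_powR // ltW.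
have w0 : 0 < s `^ th by apply: lt_le_trans w1.
have ws : 1 - s `^ (- th) <= s `^ th - 1.
  rewrite powRN; move: (s `^ th) w1 w0 => w w1 w0.
  have : 0 <= (w - 1) ^+ 2 / w by rewrite mulr_ge0 ?sqr_ge0 // invr_ge0 ltW.
  have -> : (w - 1) ^+ 2 / w = w - 2 + w^-1 by field; rewrite gt_eqF.
  lra.
have ws0 : 0 <= 1 - s `^ (- th) by rewrite powRN subr_ge0 invf_le1.
have mink0 : 0 <= Num.min kappa (kappa `^ th) by rewrite le_min !ltW.
rewrite powRN le_min; apply/andP; split.
  rewrite [leRHS]mulrAC [leRHS]mulrC; apply: ler_pM => //.
  - by rewrite le_min !mulr_ge0 ?invr_ge0 // ltW.
  - by rewrite ge_min lexx.
  - by rewrite ge_min lexx.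
apply: (@le_trans _ _
  (kappa `^ th * ((kappa `^ th)^-1 * r0 `^ (- gam) * (1 - s `^ (- th))))).
  apply: ler_pM => //.
  - by rewrite le_min !mulr_ge0 ?invr_ge0 // ltW.
  - by rewrite ge_min lexx orbT.
  - by rewrite ge_min lexx orbT.
by rewrite -mulrA mulVKf ?gt_eqF // ler_pM2l.
Qed.

Context (r : nat -> R) (r_ge0 : forall n, 0 <= r n).
Context (decay : forall n, kappa * r n.+1 `^ (gam + 1) <= r n - r n.+1).

Lemma decay_rate (s D : R) (n : nat) : 1 <= s -> 0 < D ->
  D <= Num.min (gam * kappa / s) (r 0%N `^ (- gam) * (s `^ th - 1)) ->
  (0 < n)%N -> r n <= (D^-1) `^ gam^-1 * n%:R `^ (- gam^-1).
Proof.
move=> s1 D0 Dle n0; apply: rate_of_inverse_power => // rn0.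
apply: le_trans (decay_growth k0 gam0 decay s1 rn0).
apply: ler_wpDl; first exact: powR_ge0.
by rewrite ler_wpM2l // ler0n.
Qed.

(** Here [r 0] is the gap after one iteration, whence [n.+1]: the missing unit
    is paid by the initial term [r 0 `^ (- gam)] of the growth estimate.  This
    covers the case where the gap at the starting point is infinite. *)
Lemma decay_shifted_rate : exists2 D : R, 0 < D &
  forall n, r n <= (D^-1) `^ gam^-1 * n.+1%:R `^ (- gam^-1).
Proof.
have [r00|r00] := leP (r 0%N) 0.
  exists 1 => // n; apply: (@le_trans _ _ 0); last by rewrite mulr_ge0 ?powR_ge0.
  by apply: le_trans r00; exact: decay_le0 k0 decay _.
(* the increment for the threshold [s = 2] *)
pose D0 := Num.min (gam * kappa / 2) (r 0%N `^ (- gam) * (2 `^ th - 1)).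
have tw : (1 : R) < 2 `^ th.
  rewrite -[ltLHS](_ : 1 `^ th = 1); last by rewrite powR1.
  by rewrite gt0_ltr_powR ?nnegrE // ltr1n.
have D00 : 0 < D0.
  by rewrite lt_min !mulr_gt0 ?powR_gt0 ?subr_gt0.
exists (Num.min D0 (r 0%N `^ (- gam))).
  by rewrite lt_min D00 powR_gt0.
move=> n; apply: rate_of_inverse_power => //; first by rewrite lt_min D00 powR_gt0.
move=> rn0; have s1 : 1 <= 2 :> R by rewrite ler1n.
apply: le_trans (decay_growth k0 gam0 decay s1 rn0).
rewrite -natr1 mulrDl mul1r addrC lerD //.
  by rewrite ge_min lexx orbT.
by rewrite ler_wpM2l ?ler0n // ge_min lexx.
Qed.

End Rates.

(** * One forward-backward step *)

Section ForwardBackward.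
Context {R : realType} {X : completeNormedModType R} (dot : {dot X for idfun}).
Context (hdot : induces_norm dot).
Context (g : X -> \bar R) (h : X -> R) (G : X -> X) (L lambda : R).
Context (Gg : Gamma0 g) (L0 : 0 < L) (lambda_itv : 0 < lambda < 2 / L).
Context (hG : forall x u, h x + dot (G x) (u - x) <= h u).
Context (GL : forall x y, `|G x - G y| <= L * `|x - y|).

Let f (u : X) : \bar R := (g u + (h u)%:E)%E.

Let l0 : 0 < lambda. Proof. by case/andP: lambda_itv. Qed.

Lemma prox_argmin y :
  argmin (prox_objective g (2 * lambda)^-1 y) (prox lambda g y).
Proof.
have [|z zP] := @argmin_prox_objective_nonempty _ _ dot hdot g (2 * lambda)^-1 y Gg.
  by rewrite invr_gt0 mulr_gt0.
by apply: (xgetI 0 zP).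
Qed.

Lemma prox_fin y : exists b : R, g (prox lambda g y) = b%:E.
Proof. exact: argmin_prox_objective_fin (prox_argmin y). Qed.

Lemma prox_subdifferential y :
  subdifferential dot g (prox lambda g y) (lambda^-1 *: (y - prox lambda g y)).
Proof.
have := argmin_prox_objective_subdifferential hdot Gg (prox_argmin y).
by congr (subdifferential _ _ _ (_ *: _)); field; rewrite gt_eqF.
Qed.

Section Step.

Let dot_step d e w : lambda != 0 ->
  dot (lambda^-1 *: (d - lambda *: e)) w = lambda^-1 * dot d w - dot e w.
Proof. by move=> ?; rewrite dotZl dotDl dotNl dotZl mulrBr mulKf. Qed.

Context (x : X).
Let xp := prox lambda g (x - lambda *: G x).
Let v := lambda^-1 *: ((x - xp) - lambda *: (G x - G xp)).

Let forward_subgradient u b : g xp = b%:E ->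
  ((b + lambda^-1 * dot (x - xp) (u - xp) - dot (G x) (u - xp))%:E <= g u)%E.
Proof.
move=> gxp; have := prox_subdifferential (x - lambda *: G x) u.
rewrite -/xp gxp -EFinD addrAC dot_step ?gt_eqF //.
by rewrite addrA.
Qed.

(** The subgradient [lambda^-1 (x - xp) - G x] of [g] at [xp], plus the gradient
    of [h] there. *)
Lemma forward_backward_subgradient : subdifferential dot f xp v.
Proof.
move=> u; have [b gxp] := prox_fin (x - lambda *: G x).
rewrite -/xp in gxp; have := forward_subgradient u gxp; rewrite /f gxp.
case: (g u) => [a| |] //; last by move=> _; rewrite addye // leey.
rewrite -!EFinD !lee_fin /v dot_step ?gt_eqF //.
by have := hG xp u; rewrite (dotDl _ (G x)) dotNl; lra.
Qed.

Lemma forward_backward_subgradient_le : `|v| <= lambda^-1 * `|x - xp|.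
Proof.
rewrite normrZ gtr0_norm ?invr_gt0 // ler_pM2l ?invr_gt0 //.
exact: (gradient_step_nonexpansive hdot L0 hG GL).
Qed.

(** The upper quadratic model of [h] at [x], plus the subgradient inequality of
    [g] at [xp] tested at [x]: the terms in [G x] cancel. *)
Lemma forward_backward_descent a : f x = a%:E ->
  exists2 b : R, f xp = b%:E &
    b + (2 - lambda * L) / (2 * lambda) * `|x - xp| ^+ 2 <= a.
Proof.
have [b gxp] := prox_fin (x - lambda *: G x); rewrite -/xp in gxp.
rewrite /f gxp; have := forward_subgradient x gxp.
case: (g x) => [a'| |] //; rewrite lee_fin => H [<-].
exists (b + h xp); first by [].
have := quadratic_upper_model hdot hG GL x xp.
rewrite -[xp - x]opprB dotNr normrN.
have -> : (2 - lambda * L) / (2 * lambda) * `|x - xp| ^+ 2 =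
  lambda^-1 * `|x - xp| ^+ 2 - L / 2 * `|x - xp| ^+ 2 by field; rewrite gt_eqF.
move: H; rewrite hdot; lra.
Qed.

End Step.

Lemma forward_backward_fin x :
  exists b : R, f (prox lambda g (x - lambda *: G x)) = b%:E.
Proof.
have [b gb] := prox_fin (x - lambda *: G x).
by exists (b + h (prox lambda g (x - lambda *: G x))); rewrite /f gb.
Qed.

Context (p c : R) (Omega : set X) (p0 : p < 0).
Context (floj : lojasiewicz dot p c Omega f) (m : R) (fm : inf_value f = m%:E).

(** Minimizers lie outside [domstar], but there the left-hand side is [0]. *)
Lemma lojasiewicz_subgradient x b v : Omega x -> f x = b%:E ->
  subdifferential dot f x v -> (b - m) `^ (1 - p^-1) <= c * `|v|.
Proof.
case: floj => c0 lj Ox fx vx.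
have [xmin|xmin] := pselect (argmin f x).
  have -> : b = m.
    apply/EFin_inj; rewrite -fx -fm; apply/eqP; rewrite eq_le; apply/andP; split.
      by apply: le_ereal_inf_tmp => _ [u _ <-]; exact: xmin.
    by apply: ereal_inf_lbound; exists x.
  rewrite subrr powR0; first by rewrite mulr_ge0 // ltW.
  by rewrite gt_eqF // subr_gt0 (lt_trans _ ltr01) // invr_lt0.
have : (Omega `&` domstar f) x by do 2 split => //; rewrite /dom /= fx ltry.
move=> /lj; rewrite fx fm -EFinB poweR_EFin => H.
rewrite -lee_fin; apply: le_trans H _; rewrite EFinM lee_pmul2l ?lte_fin //.
by apply: ereal_inf_lbound; exists v.
Qed.

Let kappa := lambda * (2 - lambda * L) * (2 * c ^+ 2)^-1.

(** The exponent is twice [1 - p^-1], since both the decrease of [f] and the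
    squared norm of the subgradient are measured by [|x - xp|^2]. *)
Lemma forward_backward_decay x a :
  Omega (prox lambda g (x - lambda *: G x)) -> f x = a%:E ->
  exists2 b : R, f (prox lambda g (x - lambda *: G x)) = b%:E &
  kappa * (b - m) `^ ((p - 2) / p + 1) <= (a - m) - (b - m).
Proof.
move=> Oxp fx; have [b fxp ba] := forward_backward_descent fx; exists b => //.
have := lojasiewicz_subgradient Oxp fxp (forward_backward_subgradient x).
have := forward_backward_subgradient_le x.
move: ba; set xp := prox _ _ _; set v := lambda^-1 *: _.
move=> ba vle bv; have [c0 _] := floj.
have lL : 0 < 2 - lambda * L.
  by rewrite subr_gt0 -ltr_pdivlMr //; case/andP: lambda_itv.
have -> : (b - m) `^ ((p - 2) / p + 1) = ((b - m) `^ (1 - p^-1)) ^+ 2.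
  rewrite -powR_mulrn ?powR_ge0 // -powRrM; congr (_ `^ _).
  by field; rewrite lt_eqF.
have : (b - m) `^ (1 - p^-1) <= c * (lambda^-1 * `|x - xp|).
  by apply: le_trans bv _; rewrite ler_pM2l.
rewrite -(@ler_pXn2r _ 2%N) ?nnegrE ?powR_ge0 ?mulr_ge0 ?invr_ge0 ?(ltW l0)
  ?(ltW c0) //.
have k0 : 0 < kappa by rewrite !mulr_gt0 ?invr_gt0 ?mulr_gt0 ?exprn_gt0.
rewrite -(ler_pM2l k0).
have -> : kappa * (c * (lambda^-1 * `|x - xp|)) ^+ 2 =
  (2 - lambda * L) / (2 * lambda) * `|x - xp| ^+ 2.
  by rewrite /kappa; field; rewrite !gt_eqF.
lra.
Qed.

End ForwardBackward.

(** * The convergence rate *)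

Theorem theorem4p6 (R : realType) (X : completeNormedModType R)
    (dot : {dot X for idfun}) (hdot : induces_norm dot)
    (g : X -> \bar R) (h : X -> R) (L lambda : R)
    (f : X -> \bar R := fun x => (g x + (h x)%:E)%E)
    (hg : Gamma0 g)
    (hconv : convex_function [set: convex_lmodType X] h)
    (hdiff : forall x : X, differentiable h x)
    (hL : 0 < L)
    (hlip : L.-lipschitz_setT (gradient dot h))
    (hf : bounded_below f)
    (hlambda : 0 < lambda < 2 * L^-1)
    (x : nat -> X)
    (hx : forall n : nat,
      x n.+1 = prox lambda g (x n - lambda *: gradient dot h (x n)))
    (Omega : set X) (p c : R)
    (hOmega : forall n : nat, Omega (x n))
    (hp : p < 0)
    (hloj : lojasiewicz dot p c Omega f)
    (rate : R -> Prop := fun C => forall n : nat,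
      (f (x n) - inf_value f <=
         (C `^ (p / (p - 2)))%:E * xpow n%:R (p / (2 - p)))%E) :
  (exists C : R, 0 < C /\ rate C) /\
  (forall r0 : R, (f (x 0%N) - inf_value f)%E = r0%:E -> 0 < r0 ->
     let kappa := lambda * (2 - lambda * L) * (2 * c ^+ 2)^-1 in
     let F := fun s : R =>
       Num.min ((p - 2) / (p * s))
               (kappa `^ ((2 - p) / (2 * p - 2)) * r0 `^ ((2 - p) / p)
                * (1 - s `^ (- ((p - 2) / (2 * p - 2))))) in
     exists C M : R,
       [/\ 0 < C,
           is_maximum [set F s | s in [set s : R | 1 <= s]] M,
           C^-1 = Num.min kappa (kappa `^ ((p - 2) / (2 * p - 2))) * M
         & rate C]).
Proof.
have [l0 lL] := andP hlambda.
have hG u v := gradient_le hdot v hconv (hdiff u).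
have GL u v : `|gradient dot h u - gradient dot h v| <= L * `|u - v|.
  exact: (hlip (u, v)).
have [gpr _ _] := hg.
have [m fm] : exists m : R, inf_value f = m%:E.
  have [m0 m0f] := hf; have [gNy [u gu]] := gpr.
  have lo : (m0%:E <= inf_value f)%E by apply: le_ereal_inf_tmp => _ [v _ <-].
  have : (inf_value f < +oo)%E.
    apply: le_lt_trans (_ : f u < +oo)%E; first by apply: ereal_inf_lbound; exists u.
    by rewrite /f; case: (g u) gu => // a _; rewrite -EFinD ltry.
  by case: (inf_value f) lo => [a _ _|//|//]; exists a.
have mf u : (m%:E <= f u)%E by rewrite -fm; apply: ereal_inf_lbound; exists u.
pose r n : R := fine (f (x n)) - m.
have fS n : exists b : R, f (x n.+1) = b%:E.
  by rewrite hx; exact: (forward_backward_fin hdot h (gradient dot h) hg hlambda (x n)).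
have r_ge0 n : 0 <= r n.+1.
  by rewrite /r; have := mf (x n.+1); have [b ->] := fS n; rewrite lee_fin subr_ge0.
pose kappa := lambda * (2 - lambda * L) * (2 * c ^+ 2)^-1.
pose gam := (p - 2) / p.
have pn0 : p != 0 by rewrite lt_eqF.
have gam0 : 0 < gam by rewrite ltr_ndivlMr // mul0r; lra.
have k0 : 0 < kappa.
  have [c0 _] := hloj.
  by rewrite !mulr_gt0 ?invr_gt0 ?mulr_gt0 ?exprn_gt0 // subr_gt0 -ltr_pdivlMr.
have decay n a : f (x n) = a%:E ->
    kappa * r n.+1 `^ (gam + 1) <= r n - r n.+1.
  move=> fn; have := @hOmega n.+1; rewrite /r fn hx => On.
  have [b fb kb] := forward_backward_decay hdot hg hL hlambda hG GL hp hloj fm On fn.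
  by rewrite (fb : f _ = _).
have giE : gam^-1 = p / (p - 2) by rewrite /gam invf_div.
have gNE : - gam^-1 = p / (2 - p) by rewrite giE -[2 - p]opprB invrN mulrN.
have rateP C : 0 < C ->
    (forall n, r n.+1 <= C `^ gam^-1 * n.+1%:R `^ (- gam^-1)) -> rate C.
  move=> C0 H [|n].
    (* at [n = 0] the right-hand side is [+oo] *)
    rewrite /xpow eqxx -gNE oppr_lt0 invr_gt0 gam0 /= gt0_muley ?leey //.
    by rewrite lte_fin powR_gt0.
  rewrite /xpow pnatr_eq0 /= -gNE -giE fm -EFinM.
  by have := H n; rewrite /r; have [b ->] := fS n; rewrite -EFinB lee_fin.
split.
  have [] := @decay_shifted_rate _ kappa gam k0 gam0 (fun n => r n.+1) r_ge0.
    by move=> n; have [b fb] := fS n; exact: decay fb.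
  move=> D D0 H; exists D^-1; rewrite invr_gt0; split => //.
  by apply: rateP; rewrite ?invr_gt0.
move=> r0 fr0 r00; rewrite /= -/kappa.
have [a f0] : exists a : R, f (x 0%N) = a%:E.
  by move: fr0; rewrite fm; case: (f (x 0%N)) => // a _; exists a.
have r0E : r 0%N = r0.
  by move: fr0; rewrite /r f0 fm -EFinB => -[].
pose th := gam / (gam + 1).
have p1 : 2 * p - 2 != 0 by rewrite lt_eqF //; lra.
have thE : (p - 2) / (2 * p - 2) = th.
  have -> : th = gam / ((2 * p - 2) / p) by rewrite /th /gam; congr (_ / _); field.
  by rewrite /gam; field; rewrite pn0 p1.
have thN : (2 - p) / (2 * p - 2) = - th by rewrite -thE -[2 - p]opprB mulNr.
have gN : (2 - p) / p = - gam by rewrite /gam -[2 - p]opprB mulNr.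
have gS s : (p - 2) / (p * s) = gam / s by rewrite /gam invfM mulrA.
rewrite thE thN gN.
have B0 : 0 < kappa `^ (- th) * r0 `^ (- gam) by rewrite mulr_gt0 ?powR_gt0.
have th0 : 0 < th by rewrite divr_gt0 // addr_gt0.
have [s s1 [Ms0 Ms]] := max_min_crossing gam0 B0 th0.
set M := Num.min _ _ in Ms0 Ms.
have D0 : 0 < Num.min kappa (kappa `^ th) * M.
  by rewrite mulr_gt0 // lt_min k0 powR_gt0.
exists (Num.min kappa (kappa `^ th) * M)^-1, M; split.
- by rewrite invr_gt0.
- split; first by exists s => //; rewrite gS.
  by move=> _ [t t1 <-]; rewrite gS; exact: Ms.
- by rewrite invrK.
apply: rateP; first by rewrite invr_gt0.
move=> n; apply: (decay_rate k0 gam0 _ _ s1 D0) => //.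
- case=> [|k] //; by rewrite r0E ltW.
- by move=> [|k]; [exact: decay f0|have [b fb] := fS k; exact: decay fb].
by rewrite r0E; exact: optimized_le_increment.
Qed.
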